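(* Let $0\le l\le m$ be integers and let $\tau$ be a map of $\{0,1,\ldots,m\}$ onto $\{0,1,\ldots,l\}$ (i.e. a surjection). Then $$\sum_{i,j=0}^{m}[i,j]_m\,[\tau(i),\tau(j)]_l \;\ge\; \frac{(2m+1)!\,(2l+1)!}{(m!)^2\,((l+1)!)^2}.$$
   Context: For a nonnegative integer $n$ and integers $0\le i,j\le n$, define $$[i,j]_n=\binom{i+j}{i}\binom{2n-i-j}{n-i}.$$ The sum $\sum_{i,j=0}^m$ runs over all pairs $(i,j)$ with $0\le i\le m$ and $0\le j\le m$. *)

(* Defs.v *)
From mathcomp Require Import all_boot all_order all_algebra.

Set Implicit Arguments.
Unset Strict Implicit.
Unset Printing Implicit Defensive.

(* [i,j]_n; the natural-number subtractions are exact because i, j <= n. *)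
Definition bracket (n : nat) (i j : 'I_n.+1) : nat :=
  'C(i + j, i) * 'C(2 * n - i - j, n - i).

Definition surjective (A B : Type) (f : A -> B) : Prop :=
  forall b : B, exists a : A, f a = b.

(* Main.v *)
Require Import Defs.
From mathcomp Require Import all_boot all_order all_algebra.
From mathcomp Require Import zify ring.
Local Open Scope ring_scope.

(** By Vandermonde's convolution applied to both binomial factors, the matrix
    [[i,j]_n] is a Gram matrix, and all its row sums equal [C(2n+1,n)]. Hence
    the constant vector is an eigenvector, and subtracting from a vector its
    mean shows that the quadratic form is at least
    [C(2n+1,n) / (n+1) * (\sum_i x_i)^2]. Expanding [[tau i,tau j]_l] as a Gram
    matrix, use this bound for [m], and then for [l] pulled back along [tau]. *)

Import Order.TTheory GRing.Theory Num.Theory.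

(** Classifying the subsets of $\{0,\ldots,N\}$ of size $p+q+1$ by their element $a$ of rank $p+1$
    gives the summands. *)
Lemma sum_binM_compl (N p q : nat) :
  (\sum_(a < N.+1) 'C(a, p) * 'C(N - a, q) = 'C(N.+1, (p + q).+1))%N.
Proof.
elim: N q => [|N IHN] q.
  by rewrite big_ord1 /= !bin0n; case: p q => [|p] [|q].
rewrite big_ord_recr /= subnn bin0n.
(* The last term $a = N+1$ survives only for $q = 0$. Otherwise Pascal's rule on the second factor
   splits the sum into the induction hypotheses for $q+1$ and $q$. *)
case: q => [|q].
  rewrite muln1 addn0 binS; congr (_ + _)%N.
  rewrite -[in RHS](addn0 p) -IHN.
  by apply: eq_bigr => a _; rewrite !bin0.
rewrite muln0 addn0 binS -IHN addnS -IHN -big_split /=.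
apply: eq_bigr => a _.
by rewrite subSn ?binS ?mulnDr // -ltnS.
Qed.

(** Put $a = i + j$: the row is the window $i \le a \le i+n$ of [sum_binM_compl] with $N = 2n$, $p =
    i$, $q = n-i$, and a binomial factor vanishes outside it. *)
Lemma sum_bracket (n : nat) (i : 'I_n.+1) :
  (\sum_(j < n.+1) bracket i j = 'C((2 * n).+1, n))%N.
Proof.
have le_in : (i <= n)%N by rewrite -ltnS.
have := sum_binM_compl (2 * n) i (n - i); rewrite subnKC // => /eqP.
have -> : 'C((2 * n).+1, n.+1) = 'C((2 * n).+1, n).
  by rewrite -bin_sub; [congr ('C(_, _)); lia | lia].
move=> /eqP <-.
rewrite -(big_mkord xpredT (fun a => 'C(a, i) * 'C(2 * n - a, n - i))%N).
rewrite (big_cat_nat (n := i)) /=; [|lia|lia].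
rewrite [X in (_ = X + _)%N]big_nat_cond [X in (_ = X + _)%N]big1 ?add0n; last first.
  by move=> a /andP[/andP[_ lt_ai] _]; rewrite bin_small.
rewrite (big_cat_nat (n := i + n.+1)) /=; [|lia|lia].
rewrite [X in (_ = _ + X)%N]big_nat_cond [X in (_ = _ + X)%N]big1 ?addn0; last first.
  by move=> a /andP[/andP[le_a lt_a] _]; rewrite (@bin_small (2 * n - a)) ?muln0 //; lia.
rewrite -[X in (\sum_(X <= _ < _) _)%N]add0n big_addn addKn big_mkord.
by apply: eq_bigr => j _; rewrite /bracket -subnDA (addnC i j).
Qed.

(** Vandermonde, with $\binom{a}{a-k} = \binom{a}{k}$. Padding the range with zero terms up to $n$
    makes it independent of $a$, as a Gram expansion requires. *)
Lemma bin_gram (n a b : nat) : (a <= n)%N ->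
  'C(a + b, a) = (\sum_(k < n.+1) 'C(a, k) * 'C(b, k))%N.
Proof.
move=> le_an; rewrite addnC -binomial.Vandermonde.
rewrite (eq_bigr (fun k : 'I_a.+1 => 'C(a, k) * 'C(b, k))%N); last first.
  by move=> k _; rewrite bin_sub 1?mulnC // -ltnS.
rewrite -!(big_mkord xpredT (fun k => 'C(a, k) * 'C(b, k))%N).
rewrite [RHS](big_cat_nat (n := a.+1)) //=.
rewrite [X in (_ = _ + X)%N]big_nat_cond [X in (_ = _ + X)%N]big1 ?addn0 //.
by move=> k /andP[/andP[lt_ak _] _]; rewrite bin_small.
Qed.

Definition bracket_factor {n : nat} (p : 'I_n.+1 * 'I_n.+1) (i : 'I_n.+1) : nat :=
  'C(i, p.1) * 'C(n - i, p.2).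

(** Both binomials are Gram kernels, in $(i,j)$ and in $(n-i,n-j)$; their entrywise product is one
    too, indexed by pairs. *)
Lemma bracket_gram (n : nat) (i j : 'I_n.+1) :
  bracket i j = (\sum_p bracket_factor p i * bracket_factor p j)%N.
Proof.
have le_in : (i <= n)%N by rewrite -ltnS.
have le_jn : (j <= n)%N by rewrite -ltnS.
rewrite /bracket.
have -> : (2 * n - i - j = (n - i) + (n - j))%N by lia.
rewrite (bin_gram n i j le_in) (bin_gram n (n - i) (n - j) (leq_subr i n)).
rewrite big_distrlr pair_big /=.
by apply: eq_bigr => p _; rewrite /bracket_factor mulnACA.
Qed.

Section GramBound.
Variables (R : realFieldType) (P I J : finType).
Variables (A : I -> I -> R) (v : P -> I -> R) (c : R).
Hypothesis A_gram : forall i j, A i j = \sum_p v p i * v p j.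
Hypothesis A_row : forall i, \sum_j A i j = c.

(** Separate maps [f] and [g] let one identity serve the pairings of a pulled-back vector and the
    constant vector. *)
Lemma gram_bilinear (S T : finType) (f : S -> I) (g : T -> I)
    (x : S -> R) (y : T -> R) :
  \sum_s \sum_t A (f s) (g t) * (x s * y t)
    = \sum_p (\sum_s v p (f s) * x s) * (\sum_t v p (g t) * y t).
Proof.
under [RHS]eq_bigr do rewrite big_distrlr.
rewrite [RHS]exchange_big /=; apply: eq_bigr => s _.
rewrite [RHS]exchange_big /=; apply: eq_bigr => t _.
rewrite A_gram mulr_suml; apply: eq_bigr => p _; exact: mulrACA.
Qed.

Lemma gram_row_bound (f : J -> I) (x : J -> R) :
  c / #|I|%:R * (\sum_j x j) ^+ 2
    <= \sum_i \sum_j A (f i) (f j) * (x i * x j).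
Proof.
set X := \sum_j x j.
pose u p := \sum_j v p (f j) * x j; pose w p := \sum_i v p i * 1.
have Euu : \sum_i \sum_j A (f i) (f j) * (x i * x j) = \sum_p u p * u p.
  exact: gram_bilinear.
have Euw : \sum_p u p * w p = c * X.
  rewrite -(gram_bilinear _ _ f id x (fun=> 1)) mulr_sumr; apply: eq_bigr => j _.
  by rewrite -mulr_suml A_row mulr1.
have Eww : \sum_p w p * w p = c * #|I|%:R.
  rewrite -(gram_bilinear _ _ id id (fun=> 1) (fun=> 1)).
  under eq_bigr do rewrite -mulr_suml A_row !mulr1.
  by rewrite sumr_const mulr_natr.
(* This [s] minimises the squared norm of $u - s w$, where [w] is the image of the constant vector
   $1$. *)
pose s := X / #|I|%:R.
have: 0 <= \sum_p (u p - s * w p) ^+ 2 by apply: sumr_ge0 => p _; apply: sqr_ge0.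
have -> : \sum_p (u p - s * w p) ^+ 2
    = \sum_p u p * u p - 2 * s * (\sum_p u p * w p) + s ^+ 2 * \sum_p w p * w p.
  rewrite !mulr_sumr -sumrB -big_split /=; apply: eq_bigr => p _; ring.
rewrite Euw Eww Euu -[in X in _ -> X]subr_ge0 /s.
(* For empty [I] the inverse of $0$ is $0$, so the correction terms vanish on both sides. *)
have [->|I_neq0] := eqVneq (#|I|%:R : R) 0.
  by rewrite invr0 !(mulr0, mul0r, expr0n, subr0, addr0).
by move/le_trans; apply; rewrite le_eqVlt; apply/predU1P; left; field.
Qed.

End GramBound.

Lemma bracket_bound (n : nat) (J : finType) (f : J -> 'I_n.+1) (x : J -> rat) :
  'C((2 * n).+1, n)%:R / n.+1%:R * (\sum_j x j) ^+ 2
    <= \sum_i \sum_j (bracket (f i) (f j))%:R * (x i * x j).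
Proof.
have H := @gram_row_bound _ _ _ J (fun i j => (bracket i j)%:R : rat)
  (fun p i => (bracket_factor p i)%:R) 'C((2 * n).+1, n)%:R _ _ f x.
rewrite card_ord in H; apply: H => [i j|i].
  by rewrite bracket_gram natr_sum; apply: eq_bigr => p _; rewrite natrM.
by rewrite -natr_sum sum_bracket.
Qed.

Lemma bin_central_fact (n : nat) :
  'C((2 * n).+1, n)%:R = ((2 * n + 1)`!)%:R / ((n`!)%:R ^+ 2 * n.+1%:R) :> rat.
Proof.
have <- : ('C((2 * n).+1, n) * (n`! * (n.+1)`!) = (2 * n + 1)`!)%N.
  have -> : n.+1 = ((2 * n).+1 - n)%N by lia.
  by rewrite bin_fact ?addn1 //; lia.
rewrite factS !natrM; field.
by rewrite nat1r !pnatr_eq0 -!lt0n fact_gt0.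
Qed.

Theorem theorem2 (l m : nat) (hlm : (l <= m)%N)
    (tau : 'I_m.+1 -> 'I_l.+1) (htau : surjective tau) :
  \sum_(i < m.+1) \sum_(j < m.+1)
     ((bracket i j)%:R * (bracket (tau i) (tau j))%:R : rat)
  >= (((2 * m + 1)`!)%:R * ((2 * l + 1)`!)%:R
     / ((m`!)%:R ^+ 2 * ((l.+1)`!)%:R ^+ 2) : rat).
Proof.
pose w p i : rat := (bracket_factor p (tau i))%:R.
have w_gram i j : (bracket (tau i) (tau j))%:R = \sum_p w p i * w p j.
  by rewrite bracket_gram natr_sum; apply: eq_bigr => p _; rewrite natrM.
have -> : \sum_(i < m.+1) \sum_(j < m.+1)
     ((bracket i j)%:R * (bracket (tau i) (tau j))%:R : rat)
   = \sum_p \sum_i \sum_j (bracket i j)%:R * (w p i * w p j).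
  rewrite [RHS]exchange_big /=; apply: eq_bigr => i _.
  rewrite [RHS]exchange_big /=; apply: eq_bigr => j _.
  by rewrite w_gram mulr_sumr.
pose a n : rat := 'C((2 * n).+1, n)%:R / n.+1%:R.
have a_ge0 n : 0 <= a n by rewrite divr_ge0.
have le_w : \sum_p a m * (\sum_i w p i) ^+ 2
    <= \sum_p \sum_i \sum_j (bracket i j)%:R * (w p i * w p j).
  by apply: ler_sum => p _; apply: (bracket_bound m _ id).
apply: le_trans le_w; rewrite -mulr_sumr.
(* The Gram expansion is folded back; the factor [1 * 1] matches [bracket_bound] with all weights
   $1$. *)
have -> : \sum_p (\sum_i w p i) ^+ 2
    = \sum_i \sum_j (bracket (tau i) (tau j))%:R * (1 * 1).
  under eq_bigr do rewrite expr2 big_distrlr /=.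
  rewrite exchange_big /=; apply: eq_bigr => i _.
  rewrite exchange_big /=; apply: eq_bigr => j _.
  by rewrite !mulr1 w_gram.
apply: le_trans (ler_wpM2l (a_ge0 m) (bracket_bound l _ tau (fun=> 1))).
rewrite sumr_const card_ord /a !bin_central_fact factS natrM.
(* The weights sum to $m+1$, and its square cancels the two factors $m+1$ below, so equality holds
   here. *)
rewrite le_eqVlt; apply/predU1P; left; field.
by rewrite !nat1r !pnatr_eq0 -!lt0n !fact_gt0.
Qed.
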